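(* If $D_1,D_2$ are shift equivalent UDAF digraphs, then they are weak UDAF equivalent.
   Context: $\mathbb N$ includes $0$; maps are written on the right of their arguments, and $p\circ q$ means first $p$, then $q$. A digraph $D=(V_D,E_D,s_D,t_D)$ consists of a vertex set, an edge set and functions $s_D,t_D:E_D\to V_D$ ($e$ is an edge from $(e)s_D$ to $(e)t_D$). A homomorphism $\phi:D_1\to D_2$ is a pair of maps $\phi_V$ on vertices, $\phi_E$ on edges compatible with $s$ and $t$; $\operatorname{Hom}(D_1,D_2)$ is the set of these. For $n\le m$ in $\mathbb Z\cup\{\pm\infty\}$, $\mathbb Z_{[n,m]}$ is the digraph with vertices the integers $i$ with $n\le i\le m$ and an edge $(i,i+1)$ from $i$ to $i+1$ whenever both are vertices. A bi-infinite walk in $D$ is an element of $\operatorname{Hom}(\mathbb Z_{[-\infty,\infty]},D)$. A UDAF digraph is a finite digraph $D$ such that for every $v\in V_D$ the number of $h\in\operatorname{Hom}(\mathbb Z_{[0,\infty]},D)$ with $(0)h_V=v$ is not $1$ and the number of $h\in\operatorname{Hom}(\mathbb Z_{[-\infty,0]},D)$ with $(0)h_V=v$ is not $1$. The core $D^\circ$ is the subdigraph of all edges and vertices occurring in bi-infinite walks in $D$. $(v,w)\operatorname{Adj}_D$ is the number of edges from $v$ to $w$. Shift equivalence: for a finite digraph $D$, viewing elements of $\mathbb Q^{V_D}$ as row vectors, let $K=\bigcap_{i\in\mathbb N}(\mathbb Q^{V_D})\operatorname{Adj}_D^i$, $\mathcal G_D=\{v\in\mathbb Q^{V_D}: v\operatorname{Adj}_D^i\in\mathbb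 Z^{V_D}\text{ for some }i\in\mathbb N\}\cap K$ and $\mathcal G_D^+=\{v\in\mathbb Q^{V_D}: v\operatorname{Adj}_D^i\in\mathbb N^{V_D}\text{ for some }i\in\mathbb N\}\cap K$, and $\hat\sigma_D:\mathcal G_D\to\mathcal G_D$, $(v)\hat\sigma_D=v\operatorname{Adj}_D$. The dimension module of $D$ is the triple $(\mathcal G_D,\mathcal G_D^+,\hat\sigma_D)$. Finite digraphs $D_1,D_2$ are shift equivalent if their dimension modules are isomorphic (i.e. there is a group isomorphism $\mathcal G_{D_1}\to\mathcal G_{D_2}$ mapping $\mathcal G_{D_1}^+$ onto $\mathcal G_{D_2}^+$ and intertwining $\hat\sigma_{D_1}$ and $\hat\sigma_{D_2}$). Weak UDAF equivalence: a walk $w\in\operatorname{Hom}(\mathbb Z_{[-\infty,0]},D)$ is rational if there are integers $n\le0$, $m\le-1$ with $(i)w_V=(i+m)w_V$ and $(i,i+1)w_E=(i+m,i+1+m)w_E$ for all $i<n$; otherwise irrational. Let $\sigma$ be the automorphism $i\mapsto i+1$ of $\mathbb Z_{[-\infty,\infty]}$. If $w$ is a bi-infinite walk in $D$ with $w\restriction_{\mathbb Z_{[-\infty,0]}}$ irrational and $n\in\mathbb Z$, let $R(w,n)=\{h\in\operatorname{Hom}(\mathbb Z_{[-\infty,\infty]},D): h\restriction_{\mathbb Z_{[-\infty,n]}}=w\restriction_{\mathbb Z_{[-\infty,n]}}\}$ and $R^u(w,n)=\{\langle\sigma\rangle\circ h:h\in R(w,n)\}$, where $\langle\sigma\rangle\circ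 h=\{\sigma^k\circ h:k\in\mathbb Z\}$. The sets $R^u(w,n)$ are the unindexed rays, and $(n)w_V$ is a central vertex of $R^u(w,n)$ (a ray may have several central vertices, coming from different representations). An unindexed beam is a finite union of unindexed rays. A multiset $M\in\mathbb N^{V_{D^\circ}}$ is a vertex count for an unindexed beam $B$ if $B$ is a disjoint union of unindexed rays $R_0,\dots,R_{k-1}$ having central vertices $v_0,\dots,v_{k-1}$ respectively with $(v)M=|\{i<k:v_i=v\}|$ for all $v\in V_{D^\circ}$. The relation $\sim_D$ is the equivalence relation on $\mathbb N^{V_{D^\circ}}$ generated by pairs $(M_1,M_2)$ which are both vertex counts of a common unindexed beam; it is a congruence on the additive monoid $\mathbb N^{V_{D^\circ}}$. The UDAF dimension monoid of $D$ is $\mathbb N^{V_{D^\circ}}/\sim_D$. UDAF digraphs $D_1,D_2$ are weak UDAF equivalent if their UDAF dimension monoids are isomorphic. *)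

(* Defs.v *)
From HB Require Import structures.
From Stdlib Require Import Relation_Operators.
From mathcomp Require Import all_boot all_order all_algebra.
From mathcomp Require Import generic_quotient.
From mathcomp Require Import boolp classical_sets functions cardinality.

Set Implicit Arguments.
Unset Strict Implicit.
Unset Printing Implicit Defensive.

Import Order.TTheory GRing.Theory Num.Theory.
Local Open Scope classical_set_scope.
Local Open Scope ring_scope.

Record digraph := Digraph {
  vtx : Type;
  edg : Type;
  src : edg -> vtx;
  tgt : edg -> vtx }.

Record fdigraph := FDigraph {
  fvtx : finType;
  fedg : finType;
  fsrc : fedg -> fvtx;
  ftgt : fedg -> fvtx }.

Coercion digraph_of (D : fdigraph) : digraph := Digraph (@fsrc D) (@ftgt D).

Record hom (D1 D2 : digraph) := Hom {
  homV : vtx D1 -> vtx D2;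
  homE : edg D1 -> edg D2;
  hom_src : forall e, src (homE e) = homV (src e);
  hom_tgt : forall e, tgt (homE e) = homV (tgt e) }.

(* Diagrammatic order: first p, then q. *)
Definition hcomp (D1 D2 D3 : digraph) (p : hom D1 D2) (q : hom D2 D3) :
    hom D1 D3 :=
  @Hom D1 D3 (fun v => homV q (homV p v)) (fun e => homE q (homE p e))
    (fun e => etrans (hom_src q (homE p e)) (congr1 (homV q) (hom_src p e)))
    (fun e => etrans (hom_tgt q (homE p e)) (congr1 (homV q) (hom_tgt p e))).

(* Z_[n,m] is [Zdig `[n, m]], an unbounded endpoint -oo or +oo of the interval
   playing the part of an infinite n or m. The edge (i, i + 1) is encoded by i. *)
Definition Zvtx (I : interval int) := {i : int | i \in I}.
Definition Zedg (I : interval int) := {i : int | (i \in I) && (i + 1 \in I)}.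

Definition Zsrc (I : interval int) (e : Zedg I) : Zvtx I :=
  exist _ (val e) (proj1 (andP (valP e))).
Definition Ztgt (I : interval int) (e : Zedg I) : Zvtx I :=
  exist _ (val e + 1) (proj2 (andP (valP e))).

Definition Zdig (I : interval int) : digraph := Digraph (@Zsrc I) (@Ztgt I).

Definition Zline := Zdig `]-oo, +oo[.

Lemma in_Zline (i : int) : i \in `]-oo, +oo[.
Proof. by rewrite in_itv. Qed.

Lemma edge_Zline (i : int) : (i \in `]-oo, +oo[) && (i + 1 \in `]-oo, +oo[).
Proof. by rewrite !in_Zline. Qed.

Definition Zpt (i : int) : vtx Zline := exist _ i (in_Zline i).
Definition Zedge (i : int) : edg Zline := exist _ i (edge_Zline i).

Lemma src_Zedge (i : int) : src (Zedge i) = Zpt i.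
Proof. exact: (@val_inj _ _ (Zvtx _)). Qed.

Lemma tgt_Zedge (i j : int) : i + 1 = j -> tgt (Zedge i) = Zpt j.
Proof. by move=> ij; apply: (@val_inj _ _ (Zvtx _)). Qed.

Definition Zincl (I : interval int) : hom (Zdig I) Zline :=
  @Hom (Zdig I) Zline (fun i => Zpt (val i)) (fun e => Zedge (val e))
    (fun e => src_Zedge (val e)) (fun e => tgt_Zedge (erefl (val e + 1))).

Definition restr (D : digraph) (I : interval int) (h : hom Zline D) :
    hom (Zdig I) D :=
  hcomp (Zincl I) h.

(* The k-th power of the automorphism i |-> i + 1 of Z_[-oo,+oo]. *)
Definition sigma (k : int) : hom Zline Zline :=
  @Hom Zline Zline (fun i => Zpt (val i + k)) (fun e => Zedge (val e + k))
    (fun e => src_Zedge (val e + k)) (fun e => tgt_Zedge (addrAC (val e) k 1)).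

Definition zero_future : vtx (Zdig `[0, +oo[) := exist _ (0 : int) isT.
Definition zero_past : vtx (Zdig `]-oo, 0]) := exist _ (0 : int) isT.

Definition is_udaf (D : fdigraph) : Prop :=
  forall v : vtx D,
    ~ ([set h : hom (Zdig `[0, +oo[) D | homV h zero_future = v] #= `I_1)%card /\
    ~ ([set h : hom (Zdig `]-oo, 0]) D | homV h zero_past = v] #= `I_1)%card.

Definition in_coreV (D : digraph) (v : vtx D) : Prop :=
  exists (h : hom Zline D) (i : vtx Zline), homV h i = v.
Definition in_coreE (D : digraph) (e : edg D) : Prop :=
  exists (h : hom Zline D) (i : edg Zline), homE h i = e.

Definition coreV (D : fdigraph) := {v : fvtx D | `[< in_coreV (D := D) v >]}.
Definition coreE (D : fdigraph) := {e : fedg D | `[< in_coreE (D := D) e >]}.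

Lemma core_src_subproof (D : fdigraph) (e : coreE D) :
  `[< in_coreV (D := D) (fsrc (val e)) >].
Proof.
apply/asboolP; case: e => e /= /asboolP[h [i hi]].
by exists h, (src i); rewrite -hom_src hi.
Qed.

Lemma core_tgt_subproof (D : fdigraph) (e : coreE D) :
  `[< in_coreV (D := D) (ftgt (val e)) >].
Proof.
apply/asboolP; case: e => e /= /asboolP[h [i hi]].
by exists h, (tgt i); rewrite -hom_tgt hi.
Qed.

Definition core (D : fdigraph) : fdigraph :=
  @FDigraph (coreV D) (coreE D)
    (fun e => exist _ (fsrc (val e)) (core_src_subproof e))
    (fun e => exist _ (ftgt (val e)) (core_tgt_subproof e)).

(* Q^V is realised as row vectors indexed by the enumeration of V. *)
Definition Adj (D : fdigraph) : 'M[rat]_#|fvtx D| :=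
  \matrix_(i, j)
    #|[pred e : fedg D | (fsrc e == enum_val i) && (ftgt e == enum_val j)]|%:R.

Definition dim_pred (D : fdigraph) : pred 'rV[rat]_#|fvtx D| :=
  fun v => `[< (exists i : nat, v *m Adj D ^+ i \is a mxOver Num.int) /\
               (forall i : nat, (v <= Adj D ^+ i)%MS) >].
Arguments dim_pred : clear implicits.

Lemma Adj_int (D : fdigraph) i : Adj D ^+ i \is a mxOver Num.int.
Proof.
elim: i => [|i IHi]; first by rewrite expr0 mxOver_scalar // ?rpred0 ?rpred1.
rewrite exprS mxOverM //; apply/mxOverP => j k; rewrite mxE; exact: rpred_nat.
Qed.

Lemma dim_int_later (D : fdigraph) (v : 'rV[rat]_#|fvtx D|) (i j : nat) :
  v *m Adj D ^+ i \is a mxOver Num.int ->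
  v *m Adj D ^+ (i + j) \is a mxOver Num.int.
Proof. by move=> vi; rewrite exprD mulmxA mxOverM // Adj_int. Qed.

Lemma dim_zmod_closed (D : fdigraph) : zmod_closed (dim_pred D).
Proof.
split=> [|u v].
  apply/asboolP; split=> [|i]; last exact: sub0mx.
  by exists 0%N; rewrite mul0mx mxOver0 // rpred0.
move=> /asboolP[[i ui] uK] /asboolP[[j vj] vK].
apply/asboolP; split=> [|k]; last by rewrite addmx_sub ?eqmx_opp.
exists (i + j)%N; rewrite mulmxBl; apply/mxOverP => a b; rewrite mxE [X in _ + X]mxE.
have /mxOverP/(_ a b) ua := dim_int_later j ui.
have /mxOverP/(_ a b) va := dim_int_later i vj.
by rewrite rpredB // (addnC i j).
Qed.

HB.instance Definition _ (D : fdigraph) :=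
  GRing.isZmodClosed.Build _ (dim_pred D) (dim_zmod_closed D).

Record dim_group (D : fdigraph) := DimGroup {
  dim_val : 'rV[rat]_#|fvtx D|;
  dim_valP : dim_val \in dim_pred D }.
HB.instance Definition _ (D : fdigraph) := [isSub for @dim_val D].
HB.instance Definition _ (D : fdigraph) := [Choice of dim_group D by <:].
HB.instance Definition _ (D : fdigraph) :=
  [SubChoice_isSubZmodule of dim_group D by <:].

Definition dim_pos (D : fdigraph) : set (dim_group D) :=
  [set x | exists i : nat, dim_val x *m Adj D ^+ i \is a mxOver Num.nat].
Arguments dim_pos : clear implicits.

Lemma dim_shift_subproof (D : fdigraph) (x : dim_group D) :
  dim_val x *m Adj D \in dim_pred D.
Proof.
case: x => v /= /asboolP[[i vi] vK]; apply/asboolP; split=> [|[|k]].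
- by exists i; rewrite -mulmxA -[Adj D *m _]exprS -(addn1 i) dim_int_later.
- by rewrite expr0 submx1.
- by rewrite exprSr; apply: submxMr.
Qed.

Definition dim_shift (D : fdigraph) (x : dim_group D) : dim_group D :=
  DimGroup (dim_shift_subproof x).

Definition shift_equivalent (D1 D2 : fdigraph) : Prop :=
  exists f : {additive dim_group D1 -> dim_group D2},
    [/\ bijective f,
        f @` dim_pos D1 = dim_pos D2
      & forall x, f (dim_shift x) = dim_shift (f x)].

Definition rational (D : digraph) (w : hom (Zdig `]-oo, 0]) D) : Prop :=
  exists n m : int, [/\ n <= 0, m <= -1,
    (forall i j : vtx (Zdig `]-oo, 0]),
      val i < n -> val j = val i + m -> homV w i = homV w j)
  & (forall i j : edg (Zdig `]-oo, 0]),
      val i < n -> val j = val i + m -> homE w i = homE w j)].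

Definition irrational_past (D : digraph) (w : hom Zline D) : Prop :=
  ~ rational (restr `]-oo, 0] w).

Section Beams.
Variable D : fdigraph.
Implicit Types (w : hom Zline D) (n : int).
Implicit Types (U B : set (set (hom Zline D))).

Definition unindex (h : hom Zline D) : set (hom Zline D) :=
  [set hcomp (sigma k) h | k in [set: int]].

Definition ray w n : set (hom Zline D) :=
  [set h | restr `]-oo, n] h = restr `]-oo, n] w].

Definition uray w n : set (set (hom Zline D)) := unindex @` ray w n.

Definition is_uray U : Prop :=
  exists w n, irrational_past w /\ U = uray w n.

Definition central_vertex U (v : vtx D) : Prop :=
  exists w n, [/\ irrational_past w, U = uray w n & homV w (Zpt n) = v].

Definition is_ubeam B : Prop :=
  exists (k : nat) (R : 'I_k -> set (set (hom Zline D))),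
    (forall i, is_uray (R i)) /\ B = \bigcup_(i in [set: 'I_k]) R i.

Definition vcounts := {ffun fvtx (core D) -> nat}.

Definition vertex_count B (M : vcounts) : Prop :=
  exists (k : nat) (R : 'I_k -> set (set (hom Zline D)))
         (v : 'I_k -> fvtx (core D)),
    [/\ forall i, is_uray (R i) /\ central_vertex (R i) (val (v i)),
        trivIset [set: 'I_k] R,
        B = \bigcup_(i in [set: 'I_k]) R i
      & forall x, M x = #|[pred i | v i == x]|].

Definition same_beam (M1 M2 : vcounts) : Prop :=
  exists B, [/\ is_ubeam B, vertex_count B M1 & vertex_count B M2].

Definition usim : rel vcounts :=
  fun M1 M2 => `[< clos_refl_sym_trans vcounts same_beam M1 M2 >].

Lemma usim_refl : reflexive usim.
Proof. by move=> M; apply/asboolP; apply: rst_refl. Qed.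

Lemma usim_sym : symmetric usim.
Proof.
by move=> M1 M2; apply/asboolP/asboolP; apply: rst_sym.
Qed.

Lemma usim_trans : transitive usim.
Proof.
move=> M2 M1 M3 /asboolP h12 /asboolP h23.
by apply/asboolP; apply: rst_trans h12 h23.
Qed.

Canonical usim_equiv := EquivRel usim usim_refl usim_sym usim_trans.

Definition udaf_dim := {eq_quot usim}%qT.

End Beams.

Definition udaf_class (D : fdigraph) (M : vcounts D) : udaf_dim D :=
  (\pi_(udaf_dim D) M)%qT.

(* The law of the quotient monoid is [M] + [N] = [M + N]; additivity of f is
   stated for all representatives, so that this definition does not need the
   proof that ~ is a congruence (which holds when D1 and D2 are UDAF). *)
Definition udaf_dim_iso (D1 D2 : fdigraph) (f : udaf_dim D1 -> udaf_dim D2) :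
    Prop :=
  [/\ bijective f,
      f (udaf_class 0) = udaf_class 0
    & forall (M N : vcounts D1) (M' N' : vcounts D2),
        f (udaf_class M) = udaf_class M' ->
        f (udaf_class N) = udaf_class N' ->
        f (udaf_class (M + N)) = udaf_class (M' + N')].

Definition weak_udaf_equivalent (D1 D2 : fdigraph) : Prop :=
  exists f : udaf_dim D1 -> udaf_dim D2, udaf_dim_iso f.

(* Main.v *)
From Stdlib Require Import Relation_Operators.
From mathcomp Require Import all_boot all_order all_algebra.
From mathcomp Require Import generic_quotient zify.
From mathcomp Require Import boolp classical_sets functions cardinality.
Require Import Defs.

(** Call graph congruence of the core the congruence [gcong] on vertex counts that is
    generated by identifying a vertex with the sum of the ends of the core edges leaving
    it. The theorem is proved by showing that the UDAF dimension monoid is the quotient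
    by the graph congruence, and that this quotient can be read off the dimension module:
    it is the positive cone modulo the congruence identifying every element with its
    shift.

    Two vertex counts of one beam are congruent ([same_beam_gcong]). An orbit meets a ray
    with irrational past only once, so rays that meet are nested and two partitions of a
    beam into rays have a common refinement; cutting a ray into finitely many rays amounts
    to finitely many expansions of its central vertex ([gcong_partition]). Conversely, an
    expansion is realised by a beam ([gstep_same_beam]), by cutting rays along their next
    edge, as soon as any finite family of core vertices consists of central vertices of
    disjoint rays ([disjoint_rays]). Here the UDAF condition enters: since no vertex has
    exactly one past, every walk can be modified arbitrarily far in the past ([reroute]),
    and a Baire category argument ([walk_avoiding]) gives pasts that are irrational and
    not tail equivalent to given ones.

    For the second part, a count [M] has a class [dim_class M] in the positive cone, and
    every element of the cone is represented, after sufficiently many shifts, by a count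
    ([realizes]). Different choices differ by expansions, and expanding a count shifts its
    class. Vertices outside the core do not interfere: those without infinite past carry
    no weight in the eventual range, and those without infinite future are killed by a
    power of the adjacency matrix ([zero_ext_core_part]). Hence an isomorphism of
    dimension modules induces maps on counts in both directions ([transports]) that are
    additive and mutually inverse modulo the graph congruence. *)

Set Implicit Arguments.
Unset Strict Implicit.
Unset Printing Implicit Defensive.

Import Order.TTheory GRing.Theory Num.Theory.
Local Open Scope classical_set_scope.
Local Open Scope ring_scope.

(** * Walks and rays in terms of edges *)

Section Walks.
Variable D : fdigraph.
Implicit Types (h g w : hom Zline D) (i n k t : int).

Definition edge_at h i : fedg D := homE h (Zedge i).
Definition vtx_at h i : fvtx D := homV h (Zpt i).

Lemma src_edge_at h i : fsrc (edge_at h i) = vtx_at h i.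
Proof. exact: etrans (hom_src h (Zedge i)) (congr1 (homV h) (src_Zedge i)). Qed.

Lemma tgt_edge_at h i : ftgt (edge_at h i) = vtx_at h (i + 1).
Proof.
exact: etrans (hom_tgt h (Zedge i)) (congr1 (homV h) (tgt_Zedge (erefl (i + 1)))).
Qed.

Lemma hom_ext (D1 D2 : digraph) (p q : hom D1 D2) :
  homV p =1 homV q -> homE p =1 homE q -> p = q.
Proof.
case: p q => [pV pE ps pt] [qV qE qs qt] /= /funext eV /funext eE.
by subst qV qE; congr Hom; exact: Prop_irrelevance.
Qed.

Lemma walk_ext h g : edge_at h =1 edge_at g -> h = g.
Proof.
move=> hg; apply: hom_ext => -[i Ii] /=.
- have -> : exist _ i Ii = Zpt i by exact: val_inj.
  by rewrite -/(vtx_at h i) -/(vtx_at g i) -!src_edge_at hg.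
- have -> : exist _ i Ii = Zedge i by exact: val_inj.
  exact: hg.
Qed.

Definition mkwalk (e : int -> fedg D) (He : forall i, ftgt (e i) = fsrc (e (i + 1))) :
    hom Zline D :=
  @Hom Zline D (fun v => fsrc (e (val v))) (fun x => e (val x))
    (fun=> erefl) (fun x => He (val x)).

Lemma edge_at_mkwalk e He i : edge_at (@mkwalk e He) i = e i.
Proof. by []. Qed.

Lemma splice_proof w g t : vtx_at w t = vtx_at g t ->
  forall i, ftgt (if i < t then edge_at w i else edge_at g i) =
            fsrc (if i + 1 < t then edge_at w (i + 1) else edge_at g (i + 1)).
Proof.
move=> wg i; case: ltP => it; case: ltP => it1; rewrite ?tgt_edge_at ?src_edge_at //.
- by have -> : i + 1 = t by lia.
- by lia.
Qed.

Definition splice w g t (wg : vtx_at w t = vtx_at g t) : hom Zline D :=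
  mkwalk (splice_proof wg).

Lemma edge_at_splice_lt w g t (wg : vtx_at w t = vtx_at g t) i :
  i < t -> edge_at (splice wg) i = edge_at w i.
Proof. by rewrite edge_at_mkwalk => ->. Qed.

Lemma edge_at_splice_ge w g t (wg : vtx_at w t = vtx_at g t) i :
  t <= i -> edge_at (splice wg) i = edge_at g i.
Proof. by rewrite edge_at_mkwalk ltNge => ->. Qed.

Definition shift k h : hom Zline D := hcomp (sigma k) h.

Lemma edge_at_shift k h i : edge_at (shift k h) i = edge_at h (i + k).
Proof. by []. Qed.

Lemma shiftK k l h : shift k (shift l h) = shift (k + l) h.
Proof. by apply: walk_ext => i; rewrite !edge_at_shift addrA. Qed.

Lemma shift0 h : shift 0 h = h.
Proof. by apply: walk_ext => i; rewrite edge_at_shift addr0. Qed.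

(** Restrictions to a half-line unbounded below are determined by their edges. *)
Lemma rayE w n h : ray w n h <-> forall i, i < n -> edge_at h i = edge_at w i.
Proof.
split=> [|hw].
  move=> /(congr1 (fun r => homE r)) hw i ltin.
  have Ii : (i \in `]-oo, n]) && (i + 1 \in `]-oo, n]) by rewrite !in_itv /=; lia.
  by have := congr1 (fun E => E (exist _ i Ii : edg (Zdig `]-oo, n]))) hw.
apply: hom_ext => /= -[i Ii] /=.
- rewrite in_itv /= in Ii.
  rewrite -/(vtx_at h i) -/(vtx_at w i) -[i](subrK 1) -!tgt_edge_at hw //; lia.
- by rewrite -/(edge_at h i) -/(edge_at w i); apply: hw; move: Ii; rewrite !in_itv /=; lia.
Qed.

Lemma ray_refl w n : ray w n w. Proof. exact/rayE. Qed.

Lemma ray_vtx_at w n h i : ray w n h -> i <= n -> vtx_at h i = vtx_at w i.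
Proof.
move=> /rayE hw lein; rewrite -[i](subrK 1) -!tgt_edge_at hw //; lia.
Qed.

Lemma ray_eq w n h : ray w n h -> ray h n = ray w n.
Proof.
move=> /rayE hw; apply/seteqP; split=> g /rayE gh; apply/rayE => i lin.
  by rewrite gh ?hw.
by rewrite gh ?hw.
Qed.

Lemma unindexP h g : unindex h = unindex g <-> exists k, h = shift k g.
Proof.
split=> [hg|[k ->]].
  have : unindex h h by exists 0 => //; exact: shift0.
  by rewrite hg => -[k _ <-]; exists k.
apply/seteqP; split=> x [l _ <-].
  by exists (l + k) => //; rewrite -/(shift _ _) -shiftK.
exists (l - k) => //.
by rewrite -!/(shift _ _) shiftK subrK.
Qed.

Lemma uray_eq w n h : ray w n h -> uray h n = uray w n.
Proof. by move=> /ray_eq hw; rewrite /uray hw. Qed.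

Lemma uray_shift k w n : uray (shift k w) n = uray w (n + k).
Proof.
apply/seteqP; split=> x [h /rayE hw <-].
  exists (shift (- k) h); last by apply/unindexP; exists (- k).
  apply/rayE => i lin; rewrite edge_at_shift hw; first by rewrite edge_at_shift subrK.
  lia.
exists (shift k h); last by apply/unindexP; exists k.
by apply/rayE => i lin; rewrite !edge_at_shift hw //; lia.
Qed.

Lemma urayP w n h : uray w n (unindex h) <-> exists k, ray w n (shift k h).
Proof.
split=> [[g gw /unindexP[k gh]]|[k hw]]; first by exists k; rewrite -gh.
by exists (shift k h) => //; apply/unindexP; exists k.
Qed.

(** The cut-off 0 in the definition is immaterial, as periodicity is only asked
    far enough in the past. *)
Lemma irrationalP w : irrational_past w <->
  forall t m, 0 < m -> ~ (forall i, i < t -> edge_at w i = edge_at w (i - m)).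
Proof.
split=> [irr t m m0 per|irr [t [m [t0 m1 _ per]]]].
  apply: irr; exists (Num.min t 0), (- m); split; [lia|lia| |].
  - move=> [i Ii] [j Ij] /= it ->.
    rewrite -/(vtx_at w i) -/(vtx_at w (i - m)) -[i in LHS](subrK 1).
    have -> : i - m = i - 1 - m + 1 by lia.
    by rewrite -!tgt_edge_at per //; lia.
  - move=> [i Ii] [j Ij] /= it ->.
    by rewrite -/(edge_at w i) -/(edge_at w (i - m)) per //; lia.
have m0 : 0 < - m by lia.
apply: (irr t (- m) m0) => i it; rewrite opprK.
have Ii : (i \in `]-oo, (0:int)]) && (i + 1 \in `]-oo, (0:int)]) by rewrite !in_itv /=; lia.
have Im : (i + m \in `]-oo, (0:int)]) && (i + m + 1 \in `]-oo, (0:int)])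
  by rewrite !in_itv /=; lia.
exact: (per (exist _ i Ii) (exist _ (i + m) Im)).
Qed.

Lemma irrational_tail w g t k : irrational_past g ->
  (forall i, i < t -> edge_at w i = edge_at g (i + k)) -> irrational_past w.
Proof.
move=> /irrationalP irr wg; apply/irrationalP => s m m0 per.
apply: (irr (Num.min s t + k) m m0) => i li.
have := per (i - k); rewrite wg; last by lia.
rewrite wg; last by lia.
rewrite subrK; have -> : i - k - m + k = i - m by lia.
by apply; lia.
Qed.

(** An orbit meets a ray with irrational past in one walk: two shifts of a walk
    that agree far in the past make it periodic there. This lets unindexed rays be
    treated as indexed ones. *)
Lemma ray_shift_uniq w n h k : irrational_past w ->
  ray w n h -> ray w n (shift k h) -> k = 0.
Proof.
move=> /irrationalP irr /rayE hw /rayE hkw; apply: contrapT => /eqP k0.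
have P i : i < Num.min n (n - k) -> edge_at w i = edge_at w (i + k).
  by move=> li; rewrite -hkw ?edge_at_shift ?hw //; lia.
case: (ltP k 0) => k1.
  apply: (irr (Num.min n (n - k)) (- k)); first lia.
  by move=> i li; rewrite opprK P.
apply: (irr (Num.min n (n - k)) k); first lia.
by move=> i li; rewrite [RHS]P ?subrK //; lia.
Qed.

Lemma ray_sub w n m : n <= m -> ray w m `<=` ray w n.
Proof. by move=> nm h /rayE hw; apply/rayE => i li; apply: hw; lia. Qed.

Lemma uray_sub w n m : n <= m -> uray w m `<=` uray w n.
Proof. by move=> nm; apply: image_subset; apply: ray_sub. Qed.

(** Both rays are cut from a common walk once the indexing is adjusted, and of two
    rays cut from one walk the one cut later is the smaller. *)
Lemma uray_meet w n w' n' X : uray w n X -> uray w' n' X ->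
  uray w n `<=` uray w' n' \/ uray w' n' `<=` uray w n.
Proof.
move=> [h hw <-] /urayP[k hw']; rewrite -(uray_eq hw) -(uray_eq hw') uray_shift.
by case: (leP n (n' + k)) => l; [right|left]; apply: uray_sub; rewrite // ltW.
Qed.
End Walks.

(** * Irrational pasts avoiding given tails *)

Section Reroute.
Variable D : fdigraph.
Hypothesis udafD : is_udaf D.
Implicit Types (h g w : hom Zline D) (i n k t : int).

(** Otherwise the past of [w] at [t] would be the only past of its vertex at [t],
    which the UDAF condition excludes. *)
Lemma reroute w t : exists w',
  (forall i, t <= i -> edge_at w' i = edge_at w i) /\
  exists2 i, i < t & edge_at w' i <> edge_at w i.
Proof.
pose S := [set h : hom (Zdig `]-oo, 0]) D | homV h zero_past = vtx_at w t].
pose p := restr `]-oo, 0] (shift t w).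
have Sp : S p by rewrite /S /= -[t in RHS]add0r.
have [q Sq qp] : exists2 q, S q & q <> p.
  apply: contrapT => nq.
  have Sp1 : S = [set p].
    apply/seteqP; split=> [q Sq|q /= -> //].
    by apply: contrapT => qp; apply: nq; exists q.
  by case: (udafD (vtx_at w t)) => _; apply; rewrite -/S Sp1 card_set1.
(* [q] glued to the part of [w] after [t], moved to start at 0 *)
pose e i := if insub i is Some x then homE q (x : edg (Zdig `]-oo, 0]))
            else edge_at w (i + t).
have eP i : ftgt (e i) = fsrc (e (i + 1)).
  rewrite /e; case: insubP => [x|].
    rewrite !in_itv /= => i0 xi; case: insubP => [y|].
      rewrite !in_itv /= => i1 yi.
      rewrite (hom_tgt q x : ftgt _ = _) (hom_src q y : fsrc _ = _).
      by congr (homV q); apply: val_inj => /=; rewrite xi yi.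
    rewrite !in_itv /= => i1.
    have i10 : i + 1 = 0 by lia.
    rewrite (hom_tgt q x : ftgt _ = _) src_edge_at i10 add0r -Sq.
    by congr (homV q); apply: val_inj => /=; rewrite xi.
  rewrite !in_itv /= => i0; case: insubP => [y|_].
    by rewrite !in_itv /=; lia.
  by rewrite tgt_edge_at src_edge_at addrAC.
exists (shift (- t) (mkwalk eP)); split=> [i ti|].
  rewrite edge_at_shift edge_at_mkwalk /e; case: insubP => [y|_].
    by rewrite !in_itv /=; lia.
  by rewrite subrK.
apply: contrapT => H; apply: qp.
have eqE : homE q =1 homE p.
  move=> x; apply: contrapT => qx; apply: H.
  have := valP x; rewrite !in_itv /= => /andP[_ x0].
  exists (val x + t); first by rewrite -[ltRHS]add0r ltrD2r (lt_le_trans _ x0) // ltrDl.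
  rewrite addrK /e; case: insubP => [y _ yx|]; last first.
    by rewrite (valP x).
  by have -> : y = x by exact: val_inj.
apply: hom_ext => // -[i Ii].
have Ix : (i - 1 \in `]-oo, (0:int)]) && (i - 1 + 1 \in `]-oo, (0:int)]).
  by move: Ii; rewrite !in_itv /=; lia.
have -> : exist _ i Ii = tgt (exist _ (i - 1) Ix : edg (Zdig `]-oo, 0])).
  by apply: val_inj => /=; rewrite subrK.
by rewrite -!hom_tgt eqE.
Qed.

(** A Baire category argument. Each [P x] is closed for the topology generated by
    fixing final parts of walks, and it has at most one member with a given final
    part of some length, so by [reroute] it is nowhere dense. The walk is the limit
    of pairs (walk, time from which it is kept); the step of number [j] leaves the
    set coded by [j] for good. *)
Lemma walk_avoiding (T : countType) (P : T -> set (hom Zline D)) :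
  (forall x w, ~ P x w -> exists t, forall w',
     (forall i, t <= i -> edge_at w' i = edge_at w i) -> ~ P x w') ->
  (forall x, exists t, forall w w', P x w -> P x w' ->
     (forall i, t <= i -> edge_at w i = edge_at w' i) -> edge_at w =1 edge_at w') ->
  forall w0, exists w,
    (forall i, 0 <= i -> edge_at w i = edge_at w0 i) /\ forall x, ~ P x w.
Proof.
move=> Pclosed Pdet w0.
have step (s : (hom Zline D * int)%type * nat) : exists r : hom Zline D * int,
    [/\ r.2 < s.1.2, (forall i, s.1.2 <= i -> edge_at r.1 i = edge_at s.1.1 i) &
     forall w', (forall i, r.2 <= i -> edge_at w' i = edge_at r.1 i) ->
     forall x, unpickle s.2 = Some x -> ~ P x w'].
  case: s => [[w t] j] /=; case: (unpickle j : option T) => [x|]; last first.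
    by exists (w, t - 1); split=> //=; lia.
  have [Pxw|/Pclosed[t' Pw]] := pselect (P x w); last first.
    exists (w, Num.min t' (t - 1)); split=> //=; first by lia.
    by move=> w' ww' _ [<-]; apply: Pw => i ti; apply: ww'; lia.
  have [s det] := Pdet x.
  have [w1 [ww1 [i0 i0s ww1N]]] := reroute w (Num.min t s).
  have /Pclosed[t' Pw] : ~ P x w1.
    by move=> Pw1; apply: ww1N; apply: (det w1 w) => // i si; apply: ww1; lia.
  exists (w1, Num.min t' (t - 1)); split=> /= [|i ti|]; first by lia.
    by apply: ww1; lia.
  by move=> w' ww' _ [<-]; apply: Pw => i ti; apply: ww'; lia.
have [f fP] := choice step.
pose u := fix u j := if j is j'.+1 then f (u j', j') else (w0, 0 : int).
have ut j : (u j).2 <= - (j%:Z).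
  by elim: j => [|j IHj] //=; have [] := fP (u j, j) => /=; lia.
have ustep j i : (u j).2 <= i -> edge_at (u j.+1).1 i = edge_at (u j).1 i.
  by have [_ + _] := fP (u j, j); exact.
have uE j d i : (u j).2 <= i -> edge_at (u (j + d)%N).1 i = edge_at (u j).1 i.
  move=> ji; elim: d => [|d IHd]; first by rewrite addn0.
  rewrite addnS ustep ?IHd // (le_trans _ ji) //.
  elim: d {IHd} => [|d IHd]; first by rewrite addn0.
  by rewrite addnS /=; have [] := fP (u (j + d)%N, (j + d)%N) => /=; lia.
(* [(u j).2 <= - j], so the edge at [i] is settled from stage [`|i|] on *)
pose e i := edge_at (u `|i|%N).1 i.
have eE j i : (u j).2 <= i -> e i = edge_at (u j).1 i.
  move=> ji; rewrite /e -(uE _ j); last by have := ut `|i|%N; lia.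
  by rewrite addnC uE.
have eP i : ftgt (e i) = fsrc (e (i + 1)).
  have := ut (`|i| + `|(i + 1)%R|)%N => ui.
  by rewrite !(eE (`|i| + `|(i + 1)%R|)%N) ?tgt_edge_at ?src_edge_at //; lia.
exists (mkwalk eP); split=> [i i0|x]; first by rewrite edge_at_mkwalk (eE 0%N).
have [_ _] := fP (u (pickle x), pickle x); apply; last by rewrite /= pickleK.
by move=> i; rewrite -[f _]/(u (pickle x).+1) edge_at_mkwalk => /eE.
Qed.

(** Periodicity with given period before a given time, and agreement before a given
    time with a given shift of some [b j], are closed conditions satisfied by at most
    one walk with a given final part; there are countably many of them. *)
Lemma fresh_past (b : nat -> hom Zline D) w0 : exists w,
  [/\ vtx_at w 0 = vtx_at w0 0, irrational_past w &
      forall j t k, ~ (forall i, i < t -> edge_at w i = edge_at (b j) (i + k))].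
Proof.
pose P (x : (int * nat) + (nat * int * int)) w := match x with
  | inl (t, m) => forall i, i < t -> edge_at w i = edge_at w (i - m.+1%:Z)
  | inr (j, t, k) => forall i, i < t -> edge_at w i = edge_at (b j) (i + k) end.
have [||w [ww0 Pw]] := @walk_avoiding _ P _ _ w0.
- case=> [[t m]|[[j t] k]] w /= /existsNP[i /not_implyP[it iE]].
    exists (i - m.+1%:Z) => w' ww' /(_ i it); rewrite !ww' //; lia.
  by exists i => w' ww' /(_ i it); rewrite ww'.
- case=> [[t m]|[[j t] k]] /=.
    exists (t - m.+1%:Z) => w w' wP w'P ww' i.
    have [d] := ubnP `|t - i|%N; elim: d i => // d IHd i id.
    case: (leP (t - m.+1%:Z) i) => ti; first exact: ww'.
    have iE : i = i + m.+1%:Z - m.+1%:Z by rewrite addrK.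
    by rewrite iE -wP -?w'P ?IHd //; lia.
  exists t => w w' wP w'P ww' i.
  by case: (leP t i) => [/ww'//|ti]; rewrite wP ?w'P.
exists w; split=> [||j t k]; last exact: (Pw (inr (j, t, k))).
  by rewrite -!src_edge_at ww0.
apply/irrationalP => t m m0 per; apply: (Pw (inl (t, `|m|.-1))) => i it /=.
by rewrite per //; congr (edge_at w _); lia.
Qed.
End Reroute.

(** * Beam equivalence is the graph congruence of the core *)

Section GraphCongruence.
Variable D : fdigraph.
Implicit Types (M N P Q : vcounts D).

Definition csrc (e : coreE D) : coreV D := @fsrc (core D) e.
Definition ctgt (e : coreE D) : coreV D := @ftgt (core D) e.

(** Right multiplication of a row vector by the adjacency matrix of the core. *)
Definition expand M : vcounts D := [ffun x => \sum_(e : coreE D | ctgt e == x) M (csrc e)].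

Definition delta (v : coreV D) : vcounts D := [ffun x => (x == v) : nat].

Lemma sum_deltaE (T : finType) (S : pred T) (v : T -> coreV D) x :
  (\sum_(t | S t) delta (v t)) x = #|[pred t | S t & v t == x]|.
Proof.
rewrite sum_ffunE -sum1_card big_mkcondr /=; apply: eq_bigr => t _.
by rewrite ffunE eq_sym; case: eqP.
Qed.

Lemma expandD M N : expand (M + N) = expand M + expand N.
Proof.
apply/ffunP => x; rewrite !ffunE -big_split /=.
by apply: eq_bigr => e _; rewrite ffunE.
Qed.

Lemma expand0 : expand 0 = 0.
Proof. by apply/ffunP => x; rewrite !ffunE big1 // => e _; rewrite ffunE. Qed.

Lemma expand_sum (T : finType) (S : pred T) (F : T -> vcounts D) :
  expand (\sum_(t | S t) F t) = \sum_(t | S t) expand (F t).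
Proof. exact: (big_morph expand expandD expand0). Qed.

Lemma expand_delta v : expand (delta v) = \sum_(e | csrc e == v) delta (ctgt e).
Proof.
apply/ffunP => x; rewrite sum_deltaE ffunE -sum1_card.
rewrite [LHS]big_mkcond [RHS]big_mkcond /=; apply: eq_bigr => e _.
by rewrite ffunE inE; do 2 case: eqP.
Qed.

(** The remainder [P] is kept so that the generated equivalence is a congruence. *)
Definition gstep M N := exists P Q, M = P + Q /\ N = P + expand Q.
Definition gcong := clos_refl_sym_trans (vcounts D) gstep.

Lemma gcong_addr P M N : gcong M N -> gcong (M + P) (N + P).
Proof.
elim=> [_ _ [A [B [-> ->]]]|M0|M0 N0 _|M0 N0 K0 _ + _].
- apply: rst_step; exists (P + A), B.
  by rewrite ![_ + P]addrC !addrA.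
- exact: rst_refl.
- exact: rst_sym.
- exact: rst_trans.
Qed.

Lemma gcong_add M N M' N' : gcong M N -> gcong M' N' -> gcong (M + M') (N + N').
Proof.
move=> MN MN'; apply: rst_trans (gcong_addr _ MN) _.
by rewrite ![N + _]addrC; exact: gcong_addr.
Qed.

Lemma gcong_sum (T : finType) (S : pred T) (F G : T -> vcounts D) :
  (forall t, S t -> gcong (F t) (G t)) ->
  gcong (\sum_(t | S t) F t) (\sum_(t | S t) G t).
Proof.
move=> FG; apply: (big_ind2 gcong) => //; first exact: rst_refl.
by move=> *; exact: gcong_add.
Qed.

Lemma gcong_expand M : gcong M (expand M).
Proof. by apply: rst_step; exists 0, M; rewrite !add0r. Qed.

Lemma in_core_vtx_at (w : hom Zline D) n : in_coreV (vtx_at w n : vtx D).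
Proof. by exists w, (Zpt n). Qed.

Lemma in_core_edge_at (w : hom Zline D) n : in_coreE (edge_at w n : edg D).
Proof. by exists w, (Zedge n). Qed.

Definition core_vtx_at (w : hom Zline D) n : coreV D :=
  exist _ (vtx_at w n) (asboolT (in_core_vtx_at w n)).
Definition core_edge_at (w : hom Zline D) n : coreE D :=
  exist _ (edge_at w n) (asboolT (in_core_edge_at w n)).

Lemma csrc_core_edge_at w n : csrc (core_edge_at w n) = core_vtx_at w n.
Proof. by apply: val_inj; rewrite /= src_edge_at. Qed.

Lemma ctgt_core_edge_at w n : ctgt (core_edge_at w n) = core_vtx_at w (n + 1).
Proof. by apply: val_inj; rewrite /= tgt_edge_at. Qed.

Lemma core_vertex (x : coreV D) : exists w, core_vtx_at w 0 = x.
Proof.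
have /asboolP[w [[i Ii] wx]] := valP x; exists (shift i w); apply: val_inj => /=.
by rewrite add0r -wx; congr (homV w); exact: val_inj.
Qed.

Lemma core_edge (e : coreE D) n : exists w, core_edge_at w n = e.
Proof.
have /asboolP[w [[i Ii] we]] := valP e; exists (shift (i - n) w); apply: val_inj => /=.
by rewrite addrC subrK -we; congr (homE w); exact: val_inj.
Qed.

(** A core edge lies on a bi-infinite walk, whose future is grafted onto [w]. *)
Lemma ray_extend w n (e : coreE D) : csrc e = core_vtx_at w n ->
  exists2 g, ray w n g & core_edge_at g n = e.
Proof.
have [b <-] := core_edge e n; rewrite csrc_core_edge_at => /(congr1 val) /= bw.
have wb : vtx_at w n = vtx_at b n by [].
exists (splice wb); first by apply/rayE => i lin; rewrite edge_at_splice_lt.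
by apply: val_inj; exact: (edge_at_splice_ge wb (lexx n)).
Qed.

(** Each part is [h t] cut at [m t], at most [L] levels below the ray. By induction on
    [L]: one expansion of [w n] splits the ray along the next edge, and the parts are
    distributed among the pieces. *)
Lemma gcong_partition (L : nat) (T : finType) (S : pred T)
    (h : T -> hom Zline D) (m : T -> int) w n :
  (forall t, S t -> ray w n (h t) /\ n <= m t <= n + L%:Z) ->
  (forall t t' g, S t -> S t' -> ray (h t) (m t) g -> ray (h t') (m t') g -> t = t') ->
  (forall g, ray w n g -> exists2 t, S t & ray (h t) (m t) g) ->
  gcong (delta (core_vtx_at w n)) (\sum_(t | S t) delta (core_vtx_at (h t) (m t))).
Proof.
have single (S' : pred T) w' n' t0 :
    (forall t, S' t -> ray w' n' (h t)) ->
    (forall t t' g, S' t -> S' t' -> ray (h t) (m t) g -> ray (h t') (m t') g -> t = t') ->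
    S' t0 -> m t0 = n' ->
    gcong (delta (core_vtx_at w' n')) (\sum_(t | S' t) delta (core_vtx_at (h t) (m t))).
  move=> hS' disj' St0 m0; rewrite (big_pred1 t0) => [|t].
    have -> : core_vtx_at (h t0) (m t0) = core_vtx_at w' n'.
      by apply: val_inj; rewrite /= m0; exact: ray_vtx_at (hS' _ St0) _.
    exact: rst_refl.
  apply/idP/eqP => [St|->//]; apply: (disj' t t0 (h t)) => //.
  by rewrite m0 (@ray_eq _ w') //; exact: hS'.
elim: L S w n => [|L IHL] S w n hS disj cover.
(* a part of depth 0 is the whole ray, so it is the only part *)
all: have [[t0 [St0 m0]]|no] := pselect (exists t, S t /\ m t = n).
1,3: by apply: (single S w n t0) => // t /hS[].
  have [t St _] := cover w (ray_refl _ _).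
  by case: no; exists t; split=> //; have := hS t St; lia.
apply: rst_trans (gcong_expand _) _; rewrite expand_delta.
have hS' t : S t -> csrc (core_edge_at (h t) n) == core_vtx_at w n.
  move=> St; rewrite csrc_core_edge_at; apply/eqP/val_inj => /=.
  by apply: ray_vtx_at; [exact: (hS _ St).1|].
rewrite (partition_big (fun t => core_edge_at (h t) n)
  (fun e => csrc e == core_vtx_at w n)) //=.
apply: gcong_sum => e /eqP ewn.
have [g gw ge] := ray_extend ewn.
rewrite -ge ctgt_core_edge_at.
apply: IHL => [t /andP[St /eqP hg]|t t' g' /andP[St _] /andP[St' _]|g' /rayE gg'].
- have [/rayE wh mt] := hS t St; split; last first.
    have : m t <> n by move=> mn; apply: no; exists t.
    lia.
  apply/rayE => i li; have [->|ni] := eqVneq i n; first exact: (congr1 val hg).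
  move/rayE: gw => gw; rewrite wh ?gw //; lia.
- exact: disj.
- have wg' : ray w n g'.
    by move/rayE: gw => gw; apply/rayE => i li; rewrite gg' ?gw //; lia.
  have [t St tg'] := cover g' wg'; exists t => //; rewrite St /=.
  apply/eqP/val_inj => /=; rewrite -gg'; last by lia.
  have [_ mt] := hS t St; move/rayE: tg' => -> //.
  have : m t <> n by move=> mn; apply: no; exists t.
  lia.
Qed.

(** By [ray_shift_uniq] the parts have representatives in the indexed ray, to which
    [gcong_partition] applies. With a single part it says that all central vertices
    of one ray are congruent. *)
Lemma gcong_upartition (T : finType) (S : pred T) (U : set (set (hom Zline D)))
    (R : T -> set (set (hom Zline D))) x (v : T -> coreV D) :
  central_vertex U (val x) ->
  (forall t, S t -> central_vertex (R t) (val (v t))) ->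
  (forall t t' X, S t -> S t' -> R t X -> R t' X -> t = t') ->
  (forall X, U X <-> exists2 t, S t & R t X) ->
  gcong (delta x) (\sum_(t | S t) delta (v t)).
Proof.
move=> [w [n [irr UE wx]]] cR disj UR.
have {wx} <- : core_vtx_at w n = x by exact: val_inj.
have /choice[p pP] t : exists p : hom Zline D * int, S t ->
    [/\ irrational_past p.1, R t = uray p.1 p.2, v t = core_vtx_at p.1 p.2 & ray w n p.1].
  have [St|nS] := pselect (S t); last by exists (w, n) => /nS.
  have [w' [n' [irr' RE vE]]] := cR t St.
  have /urayP[k wk] : uray w n (unindex w').
    by rewrite -UE UR; exists t => //; rewrite RE; apply/urayP; exists 0; rewrite shift0.
  exists (shift k w', n' - k) => _ /=; split => //.
  - apply: (irrational_tail (t := 0) (k := k) irr') => i _; exact: edge_at_shift.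
  - by rewrite uray_shift subrK.
  - by apply: val_inj; rewrite /= subrK -vE.
have ->: \sum_(t | S t) delta (v t) = \sum_(t | S t) delta (core_vtx_at (p t).1 (p t).2).
  by apply: eq_bigr => t /pP[_ _ ->].
have inR t g : S t -> ray (p t).1 (p t).2 g -> R t (unindex g).
  by move=> /pP[_ -> _ _] pg; apply/urayP; exists 0; rewrite shift0.
have disj' t t' g : S t -> S t' ->
    ray (p t).1 (p t).2 g -> ray (p t').1 (p t').2 g -> t = t'.
  by move=> St St' /(inR _ _ St) gt /(inR _ _ St'); exact: disj gt.
(* The part [t0] may be written with a cut below [n] if [w] cannot branch
   between the two levels: then it equals [U], and [U] is a part of [t0]. *)
have [[t0 [St0 m0]]|no] := pselect (exists t, S t /\ (p t).2 < n).
  have [irr0 R0 v0 wp0] := pP _ St0.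
  have sub0 g : ray w n g -> ray (p t0).1 (p t0).2 g.
    by rewrite -(ray_eq wp0); apply: ray_sub; exact: ltW.
  rewrite (big_pred1 t0) => [|t]; last first.
    apply/idP/eqP => [St|->//]; apply: (disj' t t0 (p t).1) => //.
    by apply: sub0; have [] := pP _ St.
  rewrite -v0; apply: rst_sym.
  have <- : core_vtx_at (p t0).1 n = core_vtx_at w n.
    by apply: val_inj; exact: ray_vtx_at wp0 _.
  have := @gcong_partition `|n - (p t0).2| unit predT (fun=> (p t0).1) (fun=> n)
            (p t0).1 (p t0).2.
  rewrite v0 big_const card_unit /= addr0; apply.
  - by move=> _ _; split; [exact: ray_refl|lia].
  - by move=> [] [].
  - move=> g gp; exists tt => //.
    have : U (unindex g) by apply/UR; exists t0 => //; exact: inR.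
    rewrite UE => /urayP[k gk].
    have k0 := ray_shift_uniq irr0 gp (sub0 _ gk).
    by move: gk; rewrite k0 shift0 (ray_eq wp0).
have mge t : S t -> n <= (p t).2.
  by move=> St; rewrite leNgt; apply/negP => lt; apply: no; exists t.
apply: (@gcong_partition (\max_(t | S t) `|(p t).2 - n|)) => // [t St|g wg].
  have [_ _ _ wp] := pP _ St; split=> //.
  have := mge _ St; have := @leq_bigmax_cond _ S (fun t => `|(p t).2 - n|%N) t St.
  by move=> /=; lia.
have : U (unindex g) by rewrite UE; apply/urayP; exists 0; rewrite shift0.
rewrite UR => -[t St]; have [_ -> _ wp] := pP _ St => /urayP[k gk].
exists t => //.
have := ray_sub (mge t St) gk; rewrite (ray_eq wp) => wgk.
by move: gk; rewrite (ray_shift_uniq irr wg wgk) shift0.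
Qed.

(** As rays that meet are nested, the intersections of the rays of one partition with
    those of the other are rays; both counts are congruent to the count of this common
    refinement. *)
Lemma same_beam_gcong M N : same_beam M N -> gcong M N.
Proof.
case=> B [_ [k [R [v [Rv Rdisj BR ME]]]] [k' [R' [v' [R'v R'disj BR' NE]]]]].
have -> : M = \sum_(i | true) delta (v i).
  by apply/ffunP => x; rewrite ME sum_deltaE; apply: eq_card.
have -> : N = \sum_(i | true) delta (v' i).
  by apply/ffunP => x; rewrite NE sum_deltaE; apply: eq_card.
(* the common refinement consists of the nonempty intersections *)
pose meet i j := `[< exists X, R i X /\ R' j X >].
have /choice[c cP] (ij : 'I_k * 'I_k') : exists c : coreV D, meet ij.1 ij.2 ->
    central_vertex (R ij.1 `&` R' ij.2) (val c).
  case: ij => i j /=.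
  have [/asboolP[X [RX R'X]]|nm] := boolP (meet i j); last by exists (v i).
  have [[w [n [_ RE]]] [_ cv1]] := ((Rv i).1, Rv i).
  have [[w' [n' [_ RE']]] [_ cv2]] := ((R'v j).1, R'v j).
  case: (@uray_meet _ w n w' n' X); rewrite -?RE -?RE' // => /setIidl RR'.
    by exists (v i) => _; rewrite RR'.
  by exists (v' j) => _; rewrite setIC RR'.
have Rd i j X : R i X -> R j X -> i = j by move=> iX jX; apply: (Rdisj i j) => //; exists X.
have R'd i j X : R' i X -> R' j X -> i = j.
  by move=> iX jX; apply: (R'disj i j) => //; exists X.
apply: (@rst_trans _ _ _ (\sum_(i | true) \sum_(j | meet i j) delta (c (i, j)))).
  apply: gcong_sum => i _.
  apply: (gcong_upartition (U := R i) (R := fun j => R i `&` R' j)).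
  - exact: (Rv i).2.
  - by move=> j; exact: cP (i, j).
  - by move=> j j' X _ _ [_ jX] [_]; exact: R'd jX.
  - move=> X; split=> [iX|[j _ []//]].
    have : B X by rewrite BR; exists i.
    by rewrite BR' => -[j _ jX]; exists j => //; apply/asboolP; exists X.
rewrite (exchange_big_dep xpredT) //=; apply: rst_sym.
apply: gcong_sum => j _.
apply: (gcong_upartition (U := R' j) (R := fun i => R i `&` R' j)).
- exact: (R'v j).2.
- by move=> i; exact: cP (i, j).
- by move=> i i' X _ _ [iX _] [+ _]; exact: Rd iX.
- move=> X; split=> [jX|[i _ []//]].
  have : B X by rewrite BR'; exists j.
  by rewrite BR => -[i _ iX]; exists i => //; apply/asboolP; exists X.
Qed.

Lemma vertex_count_family (T : finType) (S : pred T)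
    (R : T -> set (set (hom Zline D))) (v : T -> coreV D) B :
  (forall t, S t -> central_vertex (R t) (val (v t))) ->
  (forall t t' X, S t -> S t' -> R t X -> R t' X -> t = t') ->
  (forall X, B X <-> exists2 t, S t & R t X) ->
  vertex_count B (\sum_(t | S t) delta (v t)).
Proof.
move=> cR disj BR; exists #|S|, (R \o enum_val), (v \o enum_val); split.
- move=> i /=; have Si := enum_valP i; split; last exact: cR.
  by have [w [n [irr RE _]]] := cR _ Si; exists w, n.
- move=> i j _ _ [X [iX jX]]; apply: enum_val_inj.
  by apply: disj iX jX; exact: enum_valP.
- apply/seteqP; split=> X.
    move=> /BR[t St tX]; exists (enum_rank_in (St : t \in S) t) => //=.
    by rewrite enum_rankK_in.
  by move=> [i _ iX]; apply/BR; exists (enum_val i) => //; exact: enum_valP.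
- move=> x.
  have -> : \sum_(t | S t) delta (v t) =
      \sum_(i < #|S| | true) delta (v (enum_val i)).
    exact: (big_enum_val (A := S) (fun t => delta (v t))).
  by rewrite sum_deltaE; apply: eq_card.
Qed.

Lemma vertex_count_beam B M : vertex_count B M -> is_ubeam B.
Proof. by move=> [k [R [v [Rv _ BR _]]]]; exists k, R; split=> // i; have [] := Rv i. Qed.

(** The walks are chosen one after another with [fresh_past], each avoiding the tail
    classes of the earlier ones. *)
Lemma disjoint_rays (T : finType) (v : T -> coreV D) : is_udaf D ->
  exists w : T -> hom Zline D,
  [/\ forall t, irrational_past (w t), forall t, core_vtx_at (w t) 0 = v t &
      forall t t' X, uray (w t) 0 X -> uray (w t') 0 X -> t = t'].
Proof.
move=> udafD.
have [w0 w0P] := choice (fun t => core_vertex (v t)).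
(* rays cut from walks that are not tail equivalent are disjoint *)
pose teq (g h : hom Zline D) :=
  exists t k, forall i, i < t -> edge_at g i = edge_at h (i + k).
have teqC g h : teq g h -> teq h g.
  move=> [t [k gh]]; exists (t + k), (- k) => i li.
  by rewrite gh ?subrK //; lia.
suff [w [irr wv wd]] : exists w : T -> hom Zline D,
    [/\ {in enum T, forall t, irrational_past (w t)}, forall t, core_vtx_at (w t) 0 = v t &
     {in enum T &, forall t t', teq (w t) (w t') -> t = t'}].
  exists w; split=> // [t|t t' X [h hw <-] /urayP[k hw']].
    by apply: irr; rewrite mem_enum.
  apply: wd; rewrite ?mem_enum //; exists (Num.min 0 k), (- k) => i li.
  move/rayE: hw => <-; last by lia.
  move/rayE: hw' => <-; last by lia.
  by rewrite edge_at_shift subrK.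
elim: (enum T) => [|x s [w [irr wv wd]]]; first by exists w0.
have [xs|xs] := boolP (x \in s).
  have sub t : t \in x :: s -> t \in s by rewrite inE => /predU1P[->|].
  by exists w; split=> // t => [/sub|t' /sub ts /sub]; [exact: irr|exact: wd].
have [g [gx girr gd]] := fresh_past udafD (fun j => nth (w x) (map w s) j) (w x).
have gdt t : t \in s -> ~ teq g (w t).
  move=> ts [r [k gt]]; apply: (gd (index t s) r k) => i li.
  by rewrite (nth_map x) ?index_mem // nth_index // gt.
exists (fun t => if t == x then g else w t); split.
- by move=> t; rewrite inE; case: eqP => //= _; exact: irr.
- move=> t; case: eqP => [->|_]; last exact: wv.
  by rewrite -wv; apply: val_inj.
- move=> t t'; rewrite !inE; case: eqP => [->|_]; case: eqP => [->|_] //=.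
  + by move=> _ ts /(gdt _ ts).
  + by move=> ts _ /teqC/(gdt _ ts).
  + exact: wd.
Qed.

Lemma sum_delta_tag M : \sum_(t : {x : coreV D & 'I_(M x)}) delta (tag t) = M.
Proof.
have -> : \sum_(t : {x : coreV D & 'I_(M x)}) delta (tag t) =
    \sum_(x : coreV D) \sum_(i < M x) delta x by rewrite sig_big_dep.
apply/ffunP => x; rewrite sum_ffunE.
have mult y : (\sum_(i < M y) delta y) x = ((x == y) * M y)%N.
  by rewrite sum_ffunE sum_nat_const card_ord ffunE mulnC.
rewrite (eq_bigr _ (fun y _ => mult y)) (bigD1 x) //= eqxx mul1n big1 ?addr0 // => y.
by rewrite eq_sym => /negPf->.
Qed.

(** A beam with count [P + Q] is made of disjoint rays; cutting the rays that count
    towards [Q] along their next edge shows that it also has count [P + expand Q]. *)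
Lemma gstep_same_beam M N : is_udaf D -> gstep M N -> same_beam M N.
Proof.
move=> udafD [P [Q [-> ->]]].
pose TP := {x : coreV D & 'I_(P x)}; pose TQ := {x : coreV D & 'I_(Q x)}.
pose v (t : TP + TQ) := match t with inl y => tag y | inr y => tag y end.
have [w [irr wv wd]] := disjoint_rays v udafD.
pose B := [set X | exists t, uray (w t) 0 X].
have c1 : vertex_count B (P + Q).
  have -> : P + Q = \sum_(t : TP + TQ) delta (v t).
    by rewrite big_sumType /= !sum_delta_tag.
  apply: (vertex_count_family (R := fun t => uray (w t) 0)) => [t _|t t' X _ _|X].
  - by exists (w t), 0; split=> //; rewrite -wv.
  - exact: wd.
  - by split=> [[t tX]|[t _ tX]]; exists t.
have /choice[g gP] (p : TQ * coreE D) : exists g : hom Zline D, csrc p.2 = tag p.1 ->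
    ray (w (inr p.1)) 0 g /\ core_edge_at g 0 = p.2.
  have [pe|] := pselect (csrc p.2 = tag p.1); last by exists (w (inr p.1)).
  have pw : csrc p.2 = core_vtx_at (w (inr p.1)) 0 by rewrite wv.
  by have [g gw ge] := ray_extend pw; exists g.
exists B; split=> //; first exact: vertex_count_beam c1.
(* the rays of [TQ] are cut at the edge that follows their central vertex *)
pose T2 := (TP + TQ * coreE D)%type.
pose S2 (t : T2) := if t is inr p then csrc p.2 == tag p.1 else true.
pose v2 (t : T2) := match t with inl y => tag y | inr p => ctgt p.2 end.
pose R2 (t : T2) := match t with inl y => uray (w (inl y)) 0 | inr p => uray (g p) 1 end.
have -> : P + expand Q = \sum_(t | S2 t) delta (v2 t).
  rewrite big_sumType /= sum_delta_tag; congr (_ + _).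
  rewrite -{1}[Q]sum_delta_tag expand_sum.
  by rewrite (eq_bigr _ (fun y _ => expand_delta (tag y))) pair_big_dep.
pose o (t : T2) : TP + TQ := match t with inl y => inl y | inr p => inr p.1 end.
have R2sub t X : S2 t -> R2 t X -> uray (w (o t)) 0 X.
  case: t => [//|p /= /eqP/gP[gw _]]; rewrite -(uray_eq gw).
  exact: uray_sub.
apply: (vertex_count_family (R := R2)) => [[y|p] /= St|t t' X St St' tX t'X|X].
- by exists (w (inl y)), 0; split=> //; rewrite -/(v (inl y)) -wv.
- have [gw ge] := gP p (eqP St); exists (g p), 1; split=> //.
    apply: (irrational_tail (t := 0) (k := 0) (irr (inr p.1))) => i li.
    by move/rayE: gw => ->; rewrite ?addr0.
  exact: esym (congr1 val (etrans (congr1 ctgt (esym ge)) (ctgt_core_edge_at (g p) 0))).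
- have := wd _ _ _ (R2sub _ _ St tX) (R2sub _ _ St' t'X).
  case: t St tX => [y|[y e]] /= St tX; case: t' St' t'X => [y'|[y' e']] //= St' t'X.
    by move=> [->].
  move=> [yE]; subst y'.
  have [gw ge] := gP (y, e) (eqP St); have [gw' ge'] := gP (y, e') (eqP St').
  rewrite /= in gw ge gw' ge'.
  congr (inr (_, _)); rewrite -ge -ge'; apply: val_inj => /=.
  case: tX t'X => h hg <- /urayP[k hg'].
  have k0 : k = 0.
    apply: (ray_shift_uniq (irr (inr y)) (n := 0) (h := h)).
      by rewrite -(ray_eq gw); apply: ray_sub hg.
    by rewrite -(ray_eq gw'); apply: ray_sub hg'.
  rewrite k0 shift0 in hg'.
  by move/rayE: hg => <- //; move/rayE: hg' => <-.
- split=> [[t]|[t St tX]]; last by exists (o t); exact: R2sub.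
  case: t => [y yX|y [h hw <-]]; first by exists (inl y).
  have he : csrc (core_edge_at h 0) = tag y.
    rewrite csrc_core_edge_at -[RHS]/(v (inr y)) -wv; apply: val_inj; exact: ray_vtx_at hw _.
  exists (inr (y, core_edge_at h 0)) => /=; first exact/eqP.
  have [gw ge] := gP (y, core_edge_at h 0) he; rewrite /= in gw ge.
  apply/urayP; exists 0; rewrite shift0; apply/rayE => i li.
  have [->|ni] := eqVneq i 0; first exact: esym (congr1 val ge).
  move/rayE: hw => ->; last by lia.
  by move/rayE: gw => -> //; lia.
Qed.

Lemma usimE M N : is_udaf D -> usim M N = `[< gcong M N >].
Proof.
move=> udafD; apply/asboolP/asboolP.
  elim=> [M0 N0|M0|M0 N0 _|M0 N0 K0 _ + _].
  - exact: same_beam_gcong.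
  - exact: rst_refl.
  - exact: rst_sym.
  - exact: rst_trans.
elim=> [M0 N0|M0|M0 N0 _|M0 N0 K0 _ + _].
- by move=> MN; apply: rst_step; exact: gstep_same_beam.
- exact: rst_refl.
- exact: rst_sym.
- exact: rst_trans.
Qed.
End GraphCongruence.

(** * Koenig's lemma for finite relations *)

Section Konig.
Variables (T : finType) (r : rel T).

Fixpoint lasts n u := if n is n'.+1 then [exists w, r u w && lasts n' w] else true.

Lemma lasts_leq m n u : (m <= n)%N -> lasts n u -> lasts m u.
Proof.
elim: n m u => [|n IHn] [|m] u //= mn /existsP[w /andP[uw wn]].
by apply/existsP; exists w; rewrite uw (IHn m).
Qed.

(** As [lasts n u] decreases with [n], on a finite set one bound decides it for all [n]. *)
Lemma lasts_uniform : exists N, forall u, lasts N u -> forall n, lasts n u.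
Proof.
have /choice[b bP] u : exists n, lasts n u -> forall m, lasts m u.
  have [|/existsNP[n nl]] := pselect (forall m, lasts m u); first by exists 0%N.
  by exists n => /nl.
exists (\max_u b u) => u lu; apply: bP; apply: lasts_leq lu; exact: leq_bigmax.
Qed.

Lemma konig u : (forall n, lasts n u) ->
  exists2 f : nat -> T, f 0%N = u & forall i, r (f i) (f i.+1).
Proof.
move=> lu; have [N NP] := lasts_uniform.
have /choice[nxt nxtP] x : exists y, lasts N x -> r x y && lasts N y.
  have [/NP/(_ N.+1)/existsP[y]|] := pselect (lasts N x); first by exists y.
  by exists x.
have fN i : lasts N (iter i nxt u) by elim: i => //= i /nxtP/andP[].
by exists (fun i => iter i nxt u) => // i; have /andP[] := nxtP _ (fN i).
Qed.
End Konig.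

(** * Vertex counts in the dimension module *)

Section DimensionModule.
Variable D : fdigraph.
Local Notation A := (Adj D).
Implicit Types (u v : fvtx D) (M : vcounts D) (x : dim_group D).

Definition has_future u := exists a : nat -> fedg D,
  fsrc (a 0%N) = u /\ forall i, ftgt (a i) = fsrc (a i.+1).
Definition has_past u := exists a : nat -> fedg D,
  ftgt (a 0%N) = u /\ forall i, fsrc (a i) = ftgt (a i.+1).

Lemma has_past_tgt (e : fedg D) : has_past (fsrc e) -> has_past (ftgt e).
Proof.
by move=> [a [a0 aS]]; exists (fun i => if i is j.+1 then a j else e); split=> // -[|i].
Qed.

Lemma has_future_src (e : fedg D) : has_future (ftgt e) -> has_future (fsrc e).
Proof.
by move=> [a [a0 aS]]; exists (fun i => if i is j.+1 then a j else e); split=> // -[|i].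
Qed.

Lemma past_future_walk u : has_past u -> has_future u -> exists w : hom Zline D,
  vtx_at w 0 = u.
Proof.
move=> [a [a0 aS]] [b [b0 bS]].
pose e (i : int) := match i with Posz n => b n | Negz n => a n end.
have eP i : ftgt (e i) = fsrc (e (i + 1)).
  case: i => [n|[|n]].
  - by rewrite (_ : n%:Z + 1 = n.+1%:Z) ?bS //; lia.
  - by rewrite /= a0 -b0.
  - by rewrite (_ : Negz n.+1 + 1 = Negz n) /= ?aS //; lia.
by exists (mkwalk eP).
Qed.

Lemma vtx_at_past (w : hom Zline D) n : has_past (vtx_at w n).
Proof.
exists (fun i => edge_at w (n - i.+1%:Z)); split=> [|i].
  by rewrite tgt_edge_at; congr vtx_at; lia.
by rewrite tgt_edge_at src_edge_at; congr vtx_at; lia.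
Qed.

Lemma vtx_at_future (w : hom Zline D) n : has_future (vtx_at w n).
Proof.
exists (fun i => edge_at w (n + i%:Z)); split=> [|i]; first by rewrite src_edge_at addr0.
by rewrite tgt_edge_at src_edge_at; congr vtx_at; lia.
Qed.

Lemma in_coreVE u : in_coreV (u : vtx D) <-> has_past u /\ has_future u.
Proof.
split=> [[w [[i Ii] <-]]|[pu fu]].
  have -> : exist _ i Ii = Zpt i by exact: val_inj.
  by split; [exact: vtx_at_past|exact: vtx_at_future].
by have [w <-] := past_future_walk pu fu; exact: in_core_vtx_at.
Qed.

Lemma in_coreEE (e : fedg D) : has_past (fsrc e) -> has_future (ftgt e) ->
  in_coreE (e : edg D).
Proof.
move=> pe fe.
have [w we] := past_future_walk pe (has_future_src fe).
have [w' we'] := past_future_walk (has_past_tgt pe) fe.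
pose f i := if i == 0 then e else if i < 0 then edge_at w i else edge_at (shift (- 1) w') i.
have fP i : ftgt (f i) = fsrc (f (i + 1)).
  rewrite /f; case: (ltgtP i 0) => i0.
  - case: eqP => [i1|]; first by rewrite tgt_edge_at i1.
    by case: ltP => ?; [rewrite tgt_edge_at src_edge_at|lia].
  - by case: eqP => [|_]; [lia|case: ltP => ?; [lia|rewrite tgt_edge_at src_edge_at]].
  - by rewrite i0 add0r [RHS](src_edge_at w' 0).
by exists (mkwalk fP), (Zedge 0).
Qed.

Lemma mul_Adj (y : 'rV[rat]_#|fvtx D|) u :
  (y *m A) 0 (enum_rank u) = \sum_(e | ftgt e == u) y 0 (enum_rank (fsrc e)).
Proof.
rewrite mxE (partition_big (fun e : fedg D => enum_rank (fsrc e)) xpredT) //=.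
apply: eq_bigr => j _; rewrite mxE mulr_natr -sumr_const.
apply: eq_big => [e|e /andP[/eqP-> _]]; last by rewrite enum_valK.
by rewrite inE enum_rankK andbC; congr (_ && _); apply/eqP/eqP => [->|<-];
  rewrite ?enum_valK ?enum_rankK.
Qed.

Let edge_rel u v := [exists e : fedg D, (fsrc e == u) && (ftgt e == v)].

Lemma Adj_edge i j : A i j != 0 -> edge_rel (enum_val i) (enum_val j).
Proof. by rewrite mxE pnatr_eq0 -lt0n => /card_gt0P[e eP]; apply/existsP; exists e. Qed.

Lemma sum_neq0 (I : finType) (F : I -> rat) : \sum_i F i != 0 -> exists i, F i != 0.
Proof.
move=> F0; apply/existsP; apply: contraNT F0; rewrite negb_exists => /forallP F0.
by rewrite big1 // => i _; apply/eqP; have := F0 i; rewrite negbK.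
Qed.

Lemma Adj_pow_lasts n i j : (A ^+ n) i j != 0 ->
  lasts edge_rel n (enum_val i) /\ lasts (fun u v => edge_rel v u) n (enum_val j).
Proof.
elim: n i j => [|n IHn] i j // nz; split => /=.
  move: nz; rewrite exprS mxE => /sum_neq0[k]; rewrite mulf_eq0 negb_or => /andP[ik kj].
  by apply/existsP; exists (enum_val k); rewrite Adj_edge //; have [] := IHn _ _ kj.
move: nz; rewrite exprSr mxE => /sum_neq0[k]; rewrite mulf_eq0 negb_or => /andP[ik kj].
by apply/existsP; exists (enum_val k); rewrite Adj_edge //; have [] := IHn _ _ ik.
Qed.

(** A nonzero entry of a power comes from a walk of that length, and by Koenig's lemma
    long walks from (to) a vertex force an infinite one. *)
Lemma Adj_pow_live : exists N, forall n, (N <= n)%N -> forall i j, (A ^+ n) i j != 0 ->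
  has_future (enum_val i) /\ has_past (enum_val j).
Proof.
have [N1 N1P] := lasts_uniform edge_rel.
have [N2 N2P] := lasts_uniform (fun u v => edge_rel v u).
exists (maxn N1 N2) => n; rewrite geq_max => /andP[n1 n2] i j /Adj_pow_lasts[li lj]; split.
  have [f f0 fS] := konig (N1P _ (lasts_leq n1 li)).
  have /choice[e eP] k := existsP (fS k).
  exists e; split; first by have /andP[/eqP-> _] := eP 0%N.
  by move=> k; have /andP[_ /eqP->] := eP k; have /andP[/eqP-> _] := eP k.+1.
have [f f0 fS] := konig (N2P _ (lasts_leq n2 lj)).
have /choice[e eP] k := existsP (fS k).
exists e; split; first by have /andP[_ /eqP->] := eP 0%N.
by move=> k; have /andP[/eqP-> _] := eP k; have /andP[_ /eqP->] := eP k.+1.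
Qed.

Lemma Adj_pow_sub m n : (m <= n)%N -> (A ^+ n <= A ^+ m)%MS.
Proof. by move=> mn; rewrite -(subnK mn) exprD; exact: submxMl. Qed.

(** The row spaces of the powers decrease, so they are constant from a power of least
    rank on. *)
Lemma Adj_pow_stable : exists N, forall i, (A ^+ N <= A ^+ i)%MS.
Proof.
(* a power of least rank *)
have ex : exists r, `[< exists n, \rank (A ^+ n) = r >].
  by exists (\rank (A ^+ 0)); apply/asboolP; exists 0%N.
case: (ex_minnP ex) => _ /asboolP[N <-] minN; exists N => i.
have [iN|/ltnW Ni] := leqP i N; first exact: Adj_pow_sub.
have := mxrank_leqif_sup (Adj_pow_sub Ni); move=> [le_rk <-].
by rewrite eqn_leq le_rk minN //; apply/asboolP; exists i.
Qed.

Lemma stable_exponent : exists N, (forall i, (A ^+ N <= A ^+ i)%MS) /\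
  forall i j, (A ^+ N) i j != 0 -> has_future (enum_val i) /\ has_past (enum_val j).
Proof.
have [N1 N1P] := Adj_pow_live; have [N2 N2P] := Adj_pow_stable.
exists (maxn N1 N2); split=> [i|]; last by apply: N1P; exact: leq_maxl.
by apply: submx_trans (N2P i); apply: Adj_pow_sub; exact: leq_maxr.
Qed.

(** A power of the adjacency matrix that maps into the eventual range and kills every
    vertex without infinite future. *)
Definition stable_exp : nat := projT1 (cid stable_exponent).

Lemma stable_exp_sub i : (A ^+ stable_exp <= A ^+ i)%MS.
Proof. exact: (projT2 (cid stable_exponent)).1. Qed.

Lemma stable_exp_live i j : (A ^+ stable_exp) i j != 0 ->
  has_future (enum_val i) /\ has_past (enum_val j).
Proof. exact: (projT2 (cid stable_exponent)).2. Qed.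

Definition zero_ext M : 'rV[rat]_#|fvtx D| :=
  \row_i (if insub (enum_val i) is Some c then (M (c : coreV D))%:R else 0).
Definition core_part (y : 'rV[rat]_#|fvtx D|) : vcounts D :=
  [ffun c : coreV D => Num.truncn (y 0 (enum_rank (val c)))].

(** Vectors on which restriction to the core is compatible with the adjacency matrix:
    vertices without infinite past, which may feed the core, carry no weight. *)
Definition past_nat (y : 'rV[rat]_#|fvtx D|) :=
  y \is a mxOver Num.nat /\ forall u, ~ has_past u -> y 0 (enum_rank u) = 0.

Lemma zero_ext_core M (c : coreV D) : zero_ext M 0 (enum_rank (val c)) = (M c)%:R.
Proof. by rewrite mxE enum_rankK valK. Qed.

Lemma zero_ext_out M u : ~ in_coreV (u : vtx D) -> zero_ext M 0 (enum_rank u) = 0.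
Proof. by move=> nu; rewrite mxE enum_rankK insubN //; apply/asboolP. Qed.

Lemma past_nat_zero_ext M : past_nat (zero_ext M).
Proof.
split; last by move=> u pu; apply: zero_ext_out => /in_coreVE[].
by apply/mxOverP => i j; rewrite mxE; case: insub => [c|]; rewrite ?rpred_nat ?rpred0.
Qed.

Lemma zero_extK : cancel zero_ext core_part.
Proof. by move=> M; apply/ffunP => c; rewrite ffunE zero_ext_core natrK. Qed.

Lemma zero_extD M N : zero_ext (M + N) = zero_ext M + zero_ext N.
Proof.
by apply/rowP => i; rewrite !mxE; case: insub => [c|]; rewrite ?addr0 // ffunE natrD.
Qed.

Lemma zero_ext0 : zero_ext 0 = 0.
Proof. by apply/rowP => i; rewrite !mxE; case: insub => [c|] //; rewrite ffunE. Qed.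

Lemma core_part_core y (c : coreV D) : past_nat y ->
  (core_part y c)%:R = y 0 (enum_rank (val c)).
Proof. by move=> [/mxOverP/(_ 0 (enum_rank (val c))) yn _]; rewrite ffunE truncnK. Qed.

Lemma core_partD y z : past_nat y -> past_nat z ->
  core_part (y + z) = core_part y + core_part z.
Proof.
move=> gy gz; apply/ffunP => c.
by rewrite !ffunE mxE -(core_part_core c gy) -(core_part_core c gz) -natrD !natrK.
Qed.

Lemma past_nat_mul y : past_nat y -> past_nat (y *m A).
Proof.
move=> [yn yp]; split=> [|u pu].
  apply: mxOverM => //; apply/mxOverP => i j; rewrite mxE; exact: rpred_nat.
rewrite mul_Adj big1 // => e /eqP eu; apply: yp => /has_past_tgt.
by rewrite eu.
Qed.

Lemma core_part_mul y : past_nat y -> core_part (y *m A) = expand (core_part y).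
Proof.
move=> gy; apply/ffunP => c; apply/eqP; rewrite -(eqr_nat rat); apply/eqP.
rewrite core_part_core ?mul_Adj; last exact: past_nat_mul.
rewrite [expand _ _]ffunE natr_sum.
(* an edge outside the core that ends in the core starts at a vertex without past *)
rewrite (bigID (fun e => `[< in_coreE (e : edg D) >])) /= [X in _ + X]big1 ?addr0; last first.
  move=> e /andP[/eqP ec /asboolP ne]; apply: gy.2 => pe; apply: ne.
  apply: in_coreEE => //; rewrite ec.
  by have /asboolP/in_coreVE[] := valP c.
rewrite (reindex_omap (fun e : coreE D => val e) insub) /=; last first.
  by move=> e /andP[_ ec]; rewrite insubT.
apply: eq_big => [e|e _]; last by rewrite -(core_part_core (csrc e)).
by rewrite (valP e) valK eqxx !andbT -val_eqE.
Qed.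

Lemma past_nat_mulX y k : past_nat y -> past_nat (y *m A ^+ k).
Proof.
move=> gy; elim: k => [|k IHk]; first by rewrite expr0 mulmx1.
by rewrite exprSr mulmxA; exact: past_nat_mul.
Qed.

Lemma core_part_mulX y k : past_nat y ->
  core_part (y *m A ^+ k) = iter k (@expand D) (core_part y).
Proof.
move=> gy; elim: k => [|k IHk]; first by rewrite expr0 mulmx1.
by rewrite exprSr mulmxA core_part_mul ?IHk //; exact: past_nat_mulX.
Qed.

(** The difference is carried by vertices that have a past but lie outside the core;
    they have no infinite future and are killed by this power. *)
Lemma zero_ext_core_part y : past_nat y ->
  zero_ext (core_part y) *m A ^+ stable_exp = y *m A ^+ stable_exp.
Proof.
move=> gy; apply/eqP; rewrite -subr_eq0 -mulmxBl; apply/eqP/rowP => j.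
rewrite mxE [RHS]mxE big1 // => i _.
have [-> |/stable_exp_live[fi _]] := eqVneq ((A ^+ stable_exp) i j) 0; first by rewrite mulr0.
rewrite !mxE; rewrite -[i in y 0 i]enum_valK.
have [pi|npi] := pselect (has_past (enum_val i)); last first.
  rewrite insubN ?(gy.2 _ npi) ?subrr ?mul0r //.
  by apply/asboolP => /in_coreVE[].
have ci : in_coreV (enum_val i : vtx D) by apply/in_coreVE.
have cib := asboolT ci.
rewrite (insubT (fun v : fvtx D => `[< in_coreV (v : vtx D) >]) cib).
by rewrite core_part_core //= subrr mul0r.
Qed.

Lemma dim_class_subproof M : zero_ext M *m A ^+ stable_exp \in dim_pred D.
Proof.
apply/asboolP; split=> [|i]; last by apply: submx_trans (stable_exp_sub i); exact: submxMl.
exists 0%N; rewrite expr0 mulmx1; apply: mxOverM; last exact: Adj_int.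
apply/mxOverP => i j; have [/mxOverP/(_ i j) + _] := past_nat_zero_ext M; exact: intr_nat.
Qed.

(** The element of the dimension module represented by a count; multiplying by the
    power moves it into the eventual range, at the cost of a shift. *)
Definition dim_class M : dim_group D := DimGroup (dim_class_subproof M).

Lemma dim_classD M N : dim_class (M + N) = dim_class M + dim_class N.
Proof. by apply: val_inj; rewrite /= zero_extD mulmxDl. Qed.

Lemma dim_class0 : dim_class 0 = 0.
Proof. by apply: val_inj; rewrite /= zero_ext0 mul0mx. Qed.

Lemma dim_class_expand M : dim_class (expand M) = dim_shift (dim_class M).
Proof.
apply: val_inj; rewrite /= -{1}[M]zero_extK -core_part_mul; last exact: past_nat_zero_ext.
rewrite zero_ext_core_part; last exact: past_nat_mul (past_nat_zero_ext M).
by rewrite -!mulmxA -[A *m _]exprS -[_ *m A]exprSr.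
Qed.

Lemma dim_class_pos M : dim_pos D (dim_class M).
Proof.
by exists 0%N; rewrite expr0 mulmx1; have [] := past_nat_mulX stable_exp (past_nat_zero_ext M).
Qed.

(** The counts that represent [x] in the direct limit, each obtained by moving [x] far
    enough for its coordinates to be natural numbers. *)
Definition realizes x M := exists2 i,
  dim_val x *m A ^+ i \is a mxOver Num.nat & M = core_part (dim_val x *m A ^+ i).

(** Elements of the eventual range are images of a high power, which produces no weight
    on vertices without infinite past. *)
Lemma dim_past_nat x i : dim_val x *m A ^+ i \is a mxOver Num.nat ->
  past_nat (dim_val x *m A ^+ i).
Proof.
move=> xn; split=> // u pu; have /asboolP[_ /(_ stable_exp)/submxP[z ->]] := dim_valP x.
rewrite -mulmxA -[_ *m A ^+ i]exprD addnC exprD mulmxA mxE big1 // => k _.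
apply/eqP; rewrite mulf_eq0 orbC; apply/orP; left; apply: contra_notT pu => /stable_exp_live[_].
by rewrite enum_rankK.
Qed.

Lemma realizes_total x : dim_pos D x -> exists M, realizes x M.
Proof. by move=> [i xi]; exists (core_part (dim_val x *m A ^+ i)), i. Qed.

Lemma gcong_iter M k : gcong M (iter k (@expand D) M).
Proof.
elim: k => [|k IHk]; first exact: rst_refl.
by apply: rst_trans IHk _; exact: gcong_expand.
Qed.

Lemma realizes_later x i k : dim_val x *m A ^+ i \is a mxOver Num.nat ->
  dim_val x *m A ^+ (i + k) \is a mxOver Num.nat /\
  gcong (core_part (dim_val x *m A ^+ i)) (core_part (dim_val x *m A ^+ (i + k))).
Proof.
move=> /dim_past_nat gx; rewrite exprD mulmxA; split; first by have [] := past_nat_mulX k gx.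
by rewrite (core_part_mulX k gx); exact: gcong_iter.
Qed.

(** Two exponents give counts that become equal after some expansions. *)
Lemma realizes_uniq x M M' : realizes x M -> realizes x M' -> gcong M M'.
Proof.
move=> [i xi ->] [j xj ->]; have [_ ij] := realizes_later j xi.
apply: rst_trans ij _; apply: rst_sym; rewrite addnC.
by have [] := realizes_later i xj.
Qed.

Lemma realizesD x y M N K : realizes x M -> realizes y N -> realizes (x + y) K ->
  gcong K (M + N).
Proof.
move=> [i xi ->] [j yj ->] xyK.
have [xij cx] := realizes_later j xi; have [yij cy] := realizes_later i yj.
rewrite addnC in yij cy.
apply: rst_trans (rst_sym _ _ _ _ (gcong_add cx cy)).
apply: realizes_uniq xyK _; exists (i + j)%N; rewrite /= mulmxDl.
  apply/mxOverP => a b; rewrite mxE rpredD //; exact: mxOverP.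
by rewrite core_partD //; exact: dim_past_nat.
Qed.

Lemma realizes_shift x M : realizes x M -> realizes (dim_shift x) (expand M).
Proof.
move=> [i xi ->]; have gx := dim_past_nat xi.
have E : dim_val (dim_shift x) *m A ^+ i = dim_val x *m A ^+ i *m A.
  by rewrite /= -!mulmxA -[A *m _]exprS -[_ *m A]exprSr.
exists i; rewrite E; first by have [] := past_nat_mul gx.
by rewrite core_part_mul.
Qed.

Lemma realizes_dim_class M M' : realizes (dim_class M) M' -> gcong M M'.
Proof.
move=> [i _ ->]; rewrite /= -mulmxA -[_ *m A ^+ i]exprD.
rewrite (core_part_mulX _ (past_nat_zero_ext M)).
by rewrite zero_extK; exact: gcong_iter.
Qed.

Lemma dim_val_iter_shift x k : dim_val (iter k (@dim_shift D) x) = dim_val x *m A ^+ k.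
Proof.
by elim: k => [|k IHk]; rewrite ?mulmx1 //= IHk exprSr mulmxA.
Qed.

Lemma dim_class_iter M k : dim_class (iter k (@expand D) M) = iter k (@dim_shift D) (dim_class M).
Proof. by elim: k => //= k IHk; rewrite dim_class_expand IHk. Qed.

Lemma dim_class_realized x M : realizes x M -> exists k, dim_class M = iter k (@dim_shift D) x.
Proof.
move=> [i /dim_past_nat gx ->]; exists (i + stable_exp)%N; apply: val_inj.
by rewrite [RHS]dim_val_iter_shift /= zero_ext_core_part // exprD mulmxA.
Qed.
End DimensionModule.

(** * Transport of counts along maps of dimension modules *)

Section Transport.
Variables (D1 D2 : fdigraph) (f : dim_group D1 -> dim_group D2).
Hypothesis fD : forall x y, f (x + y) = f x + f y.
Hypothesis f_pos : forall x, dim_pos D1 x -> dim_pos D2 (f x).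
Hypothesis f_shift : forall x, f (dim_shift x) = dim_shift (f x).

(** The multivalued map on counts induced by a map [f] of dimension modules; it is
    single-valued modulo [gcong]. *)
Definition transports (M : vcounts D1) (M' : vcounts D2) := realizes (f (dim_class M)) M'.

Lemma transports_total M : exists M', transports M M'.
Proof. by apply: realizes_total; apply: f_pos; exact: dim_class_pos. Qed.

Lemma transportsD M N M' N' K : transports M M' -> transports N N' ->
  transports (M + N) K -> gcong K (M' + N').
Proof. by rewrite /transports dim_classD fD; exact: realizesD. Qed.

Lemma transports_expand M M' : transports M M' -> transports (expand M) (expand M').
Proof. by rewrite /transports dim_class_expand f_shift; exact: realizes_shift. Qed.

(** [f] commutes with the shift, which on counts is an expansion, so it respects the
    generators of the congruence. *)
Lemma transports_gcong M N M' N' : gcong M N ->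
  transports M M' -> transports N N' -> gcong M' N'.
Proof.
move=> MN; elim: MN M' N' =>
  {M N} [_ _ [P [Q [-> ->]]]|M|M N _ IH|M N K _ IH1 _ IH2] M' N' tM tN.
- have [P' tP] := transports_total P; have [Q' tQ] := transports_total Q.
  apply: rst_trans (transportsD tP tQ tM) _.
  apply: rst_trans (gcong_add (rst_refl _ _ P') (gcong_expand Q')) _.
  by apply: rst_sym; apply: transportsD tP (transports_expand tQ) tN.
- exact: realizes_uniq tM tN.
- by apply: rst_sym; exact: IH.
- have [K' tK] := transports_total N.
  exact: rst_trans (IH1 _ _ tM tK) (IH2 _ _ tK tN).
Qed.

Lemma transports0 : transports 0 0.
Proof.
have f0 : f 0 = 0 by apply: (addIr (f 0)); rewrite -fD !add0r.
rewrite /transports dim_class0 f0; exists 0%N; rewrite mul0mx; first exact: mxOver0.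
by rewrite -zero_ext0 zero_extK.
Qed.

Lemma iter_shift_commute k x : f (iter k (@dim_shift D1) x) = iter k (@dim_shift D2) (f x).
Proof. by elim: k => //= k IHk; rewrite f_shift IHk. Qed.

End Transport.

(** Passing to the other module and back moves a count by a power of the shift, that
    is, by expansions. *)
Lemma transports_inv (D1 D2 : fdigraph) (f : dim_group D1 -> dim_group D2) g M M' M'' :
  (forall x, g (dim_shift x) = dim_shift (g x)) -> cancel f g ->
  transports f M M' -> transports g M' M'' -> gcong M'' M.
Proof.
move=> g_shift fK /dim_class_realized[k iM'].
rewrite /transports iM' (iter_shift_commute g_shift) fK -dim_class_iter => /realizes_dim_class MM''.
by apply: rst_sym; apply: rst_trans (gcong_iter M k) MM''.
Qed.

(** * The induced isomorphism of UDAF dimension monoids *)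

Lemma udaf_classP (D : fdigraph) (M N : vcounts D) : is_udaf D ->
  udaf_class M = udaf_class N <-> gcong M N.
Proof.
move=> uD; split=> [/eqmodP|MN]; first by rewrite /= usimE // => /asboolP.
by apply/eqmodP; rewrite /= usimE //; exact/asboolP.
Qed.

Lemma udaf_class_surj (D : fdigraph) (c : udaf_dim D) : exists M, c = udaf_class M.
Proof. by exists (repr c); rewrite /udaf_class reprK. Qed.

Theorem theorem8p3 (D1 D2 : fdigraph) (hD1 : is_udaf D1) (hD2 : is_udaf D2)
  (hD : shift_equivalent D1 D2) : weak_udaf_equivalent D1 D2.
Proof.
have [f [[g fK gK] fpos fS]] := hD.
have fD x y : f (x + y) = f x + f y by exact: raddfD.
have fP x : dim_pos D1 x -> dim_pos D2 (f x) by move=> px; rewrite -fpos; exists x.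
have gD x y : g (x + y) = g x + g y by apply: (can_inj fK); rewrite gK fD !gK.
have gP x : dim_pos D2 x -> dim_pos D1 (g x) by rewrite -fpos => -[y py <-]; rewrite fK.
have gS x : g (dim_shift x) = dim_shift (g x) by apply: (can_inj fK); rewrite gK fS gK.
have lift (Da Db : fdigraph) (h : dim_group Da -> dim_group Db) :
    is_udaf Da -> is_udaf Db -> (forall x y, h (x + y) = h x + h y) ->
    (forall x, dim_pos Da x -> dim_pos Db (h x)) ->
    (forall x, h (dim_shift x) = dim_shift (h x)) ->
    exists F : udaf_dim Da -> udaf_dim Db, forall M M', transports h M M' ->
      F (udaf_class M) = udaf_class M'.
  move=> ua ub hD' hP hS.
  have /choice[F FP] c : exists c', exists M M',
      [/\ c = udaf_class M, c' = udaf_class M' & transports h M M'].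
    have [M ->] := udaf_class_surj c; have [M' tM] := transports_total hP M.
    by exists (udaf_class M'), M, M'.
  exists F => M M' tM; have [N [N' [/(udaf_classP _ _ ua) MN -> tN]]] := FP (udaf_class M).
  by apply/udaf_classP => //; apply: transports_gcong (rst_sym _ _ _ _ MN) tN tM.
have [F FE] := lift _ _ _ hD1 hD2 fD fP fS.
have [G GE] := lift _ _ _ hD2 hD1 gD gP gS.
exists F; split.
- exists G => c.
    have [M ->] := udaf_class_surj c; have [M' tM] := transports_total fP M.
    have [M'' tM'] := transports_total gP M'.
    rewrite (FE _ _ tM) (GE _ _ tM'); apply/udaf_classP => //.
    exact: transports_inv gS fK tM tM'.
  have [M ->] := udaf_class_surj c; have [M' tM] := transports_total gP M.
  have [M'' tM'] := transports_total fP M'.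
  rewrite (GE _ _ tM) (FE _ _ tM'); apply/udaf_classP => //.
  exact: transports_inv fS gK tM tM'.
- exact: FE (transports0 fD).
- move=> M N M' N'.
  have [P tP] := transports_total fP M; have [Q tQ] := transports_total fP N.
  have [K tK] := transports_total fP (M + N).
  rewrite (FE _ _ tP) (FE _ _ tQ) (FE _ _ tK).
  move=> /(udaf_classP _ _ hD2) PM /(udaf_classP _ _ hD2) QN.
  apply/udaf_classP => //; apply: rst_trans (transportsD fD tP tQ tK) _.
  exact: gcong_add.
Qed.
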